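(* Let $p\ge 1$, let $\Gamma:\Omega\to\mathcal{K}_c(\mathbb{R}^p)$ be a compact convex random set on a probability space $(\Omega,\mathcal{A},\mathbb{P})$, and let $K\in\mathcal{K}_c(\mathbb{R}^p)$ maximize $D_{CT}(\cdot;\Gamma)$ over $\mathcal{K}_c(\mathbb{R}^p)$. Then $$D_{CT}\big((1-\lambda)\cdot K+\lambda\cdot L;\Gamma\big)\ge D_{CT}(L;\Gamma)$$ for all $\lambda\in[0,1]$ and all $L\in\mathcal{K}_c(\mathbb{R}^p)$.
   Context: $\mathcal{K}_c(\mathbb{R}^p)$ denotes the set of non-empty compact convex subsets of $\mathbb{R}^p$, and $\mathbb{S}^{p-1}=\{x\in\mathbb{R}^p:\|x\|=1\}$ the Euclidean unit sphere. The support function of $K\in\mathcal{K}_c(\mathbb{R}^p)$ is $s_K:\mathbb{S}^{p-1}\to\mathbb{R}$, $s_K(u)=\sup_{k\in K}\langle k,u\rangle$. For $K,L\in\mathcal{K}_c(\mathbb{R}^p)$ and $\gamma\ge 0$, $K+L=\{k+l:k\in K,l\in L\}$ and $\gamma\cdot K=\{\gamma k:k\in K\}$. A map $\Gamma:\Omega\to\mathcal{K}_c(\mathbb{R}^p)$ on a probability space $(\Omega,\mathcal{A},\mathbb{P})$ is a compact convex random set if $\{\omega\in\Omega:\Gamma(\omega)\cap K\ne\emptyset\}\in\mathcal{A}$ for all $K\in\mathcal{K}_c(\mathbb{R}^p)$; equivalently, it is Borel measurable with respect to the Hausdorff metric. For $u\in\mathbb{S}^{p-1}$, $t\in\mathbb{R}$,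 define the halfspaces $S^-_{u,t}=\{K\in\mathcal{K}_c(\mathbb{R}^p):s_K(u)\le t\}$ and $S^+_{u,t}=\{K\in\mathcal{K}_c(\mathbb{R}^p):s_K(u)\ge t\}$. The Tukey depth of $K\in\mathcal{K}_c(\mathbb{R}^p)$ with respect to $\Gamma$ is $$D_{CT}(K;\Gamma)=\min\Big\{\inf_{u\in\mathbb{S}^{p-1},\,t\in\mathbb{R}:\ K\in S^-_{u,t}}\mathbb{P}(\Gamma\in S^-_{u,t}),\ \inf_{u\in\mathbb{S}^{p-1},\,t\in\mathbb{R}:\ K\in S^+_{u,t}}\mathbb{P}(\Gamma\in S^+_{u,t})\Big\}.$$ *)

(* Defs.v *)
From HB Require Import structures.
From mathcomp Require Import all_boot all_order all_algebra.
From mathcomp Require Import all_classical all_reals all_analysis.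

Set Implicit Arguments.
Unset Strict Implicit.
Unset Printing Implicit Defensive.

Import Order.TTheory GRing.Theory Num.Theory.
Import numFieldNormedType.Exports.

Local Open Scope classical_set_scope.
Local Open Scope ring_scope.

(* R^p is 'rV[R]_p. Its canonical norm `|x| in the library is the sup norm,
   which induces the usual topology (so [compact] below is the usual notion)
   but not the Euclidean unit sphere; hence [enorm]. *)
Definition dotr (R : realType) (p : nat) (x y : 'rV[R]_p) : R :=
  \sum_(i < p) x 0 i * y 0 i.

Definition enorm (R : realType) (p : nat) (x : 'rV[R]_p) : R :=
  Num.sqrt (dotr x x).

Definition unit_sphere (R : realType) (p : nat) : set 'rV[R]_p :=
  [set x | enorm x = 1].

Record convex_body (R : realType) (p : nat) := ConvexBody {
  body_set :> set 'rV[R]_p;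
  body_nonempty : body_set !=set0;
  body_compact : compact body_set;
  body_convex : convex_set body_set
}.

Section minkowski_operations.
Variables (R : realType) (p : nat).
Implicit Types (K L : convex_body R p) (g : R).

Definition minkowski_add_set K L : set 'rV[R]_p :=
  [set k + l | k in (K : set _) & l in (L : set _)].

Definition minkowski_scale_set g K : set 'rV[R]_p :=
  [set g *: k | k in (K : set _)].

Lemma minkowski_add_nonempty K L : minkowski_add_set K L !=set0.
Proof.
have [k Kk] := body_nonempty K; have [l Ll] := body_nonempty L.
by exists (k + l); exists k => //; exists l.
Qed.

Lemma minkowski_add_compact K L : compact (minkowski_add_set K L).
Proof.
have -> : minkowski_add_set K L =
    (fun z : 'rV[R]_p * 'rV[R]_p => z.1 + z.2) @` ((K : set _) `*` (L : set _)).
  apply/seteqP; split => [_ [k Kk [l Ll <-]]|_ [[k l] [/= Kk Ll] <-]].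
    by exists (k, l).
  by exists k => //; exists l.
apply: continuous_compact.
  by apply: continuous_subspaceT => z; exact: add_continuous.
by apply: compact_setX; exact: body_compact.
Qed.

Lemma minkowski_add_convex K L : convex_set (minkowski_add_set K L).
Proof.
move=> x y t /set_mem[k Kk [l Ll <-]] /set_mem[k' Kk' [l' Ll' <-]].
apply/mem_set; exists (conv t (k : convex_lmodType _) k').
  by apply/set_mem/body_convex; apply/mem_set.
exists (conv t (l : convex_lmodType _) l').
  by apply/set_mem/body_convex; apply/mem_set.
by rewrite /conv/= !scalerDr addrACA.
Qed.

Lemma minkowski_scale_nonempty g K : minkowski_scale_set g K !=set0.
Proof. by have [k Kk] := body_nonempty K; exists (g *: k), k. Qed.

Lemma minkowski_scale_compact g K : compact (minkowski_scale_set g K).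
Proof.
apply: continuous_compact; last exact: body_compact.
by apply: continuous_subspaceT => z; exact: scaler_continuous.
Qed.

Lemma minkowski_scale_convex g K : convex_set (minkowski_scale_set g K).
Proof.
move=> x y t /set_mem[k Kk <-] /set_mem[k' Kk' <-].
apply/mem_set; exists (conv t (k : convex_lmodType _) k').
  by apply/set_mem/body_convex; apply/mem_set.
by rewrite /conv/= scalerDr !scalerA ![g * _]mulrC.
Qed.

Definition minkowski_add K L : convex_body R p :=
  ConvexBody (@minkowski_add_nonempty K L) (@minkowski_add_compact K L)
    (@minkowski_add_convex K L).

Definition minkowski_scale g K : convex_body R p :=
  ConvexBody (@minkowski_scale_nonempty g K) (@minkowski_scale_compact g K)
    (@minkowski_scale_convex g K).

End minkowski_operations.

(* The supremum is that of a nonempty bounded set, as K is nonempty and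
   compact, so [sup] is not used outside its domain. *)
Definition support_function (R : realType) (p : nat) (K : convex_body R p)
    (u : 'rV[R]_p) : R :=
  sup [set dotr k u | k in (K : set _)].

Definition halfspace_le (R : realType) (p : nat) (u : 'rV[R]_p) (t : R) :
    set (convex_body R p) :=
  [set K | support_function K u <= t].

Definition halfspace_ge (R : realType) (p : nat) (u : 'rV[R]_p) (t : R) :
    set (convex_body R p) :=
  [set K | t <= support_function K u].

Definition compact_convex_random_set (d : measure_display)
    (Omega : measurableType d) (R : realType) (p : nat)
    (Gamma : Omega -> convex_body R p) : Prop :=
  forall K : convex_body R p,
    measurable [set w | (Gamma w : set _) `&` (K : set _) !=set0].

Definition tukey_depth (d : measure_display) (Omega : measurableType d)
    (R : realType) (p : nat) (P : probability Omega R)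
    (Gamma : Omega -> convex_body R p) (K : convex_body R p) : \bar R :=
  Order.min
    (ereal_inf [set P (Gamma @^-1` halfspace_le ut.1 ut.2) |
       ut in [set ut : 'rV[R]_p * R |
         @unit_sphere R p ut.1 /\ halfspace_le ut.1 ut.2 K]])
    (ereal_inf [set P (Gamma @^-1` halfspace_ge ut.1 ut.2) |
       ut in [set ut : 'rV[R]_p * R |
         @unit_sphere R p ut.1 /\ halfspace_ge ut.1 ut.2 K]]).

(* Main.v *)
Require Import Defs.
From HB Require Import structures.
From mathcomp Require Import all_boot all_order all_algebra.
From mathcomp Require Import all_classical all_reals all_analysis.

Import Order.TTheory GRing.Theory Num.Theory.
Import numFieldNormedType.Exports.

Local Open Scope classical_set_scope.
Local Open Scope ring_scope.

(** The support function turns Minkowski combinations into real ones: for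
[M = (1 - lambda) K + lambda L] and every direction [u],
[s_M u = (1 - lambda) * s_K u + lambda * s_L u]
([support_functionD], [support_functionZ]).  This real number lies between
[s_K u] and [s_L u], so a halfspace [s(u) <= t] or [s(u) >= t] that contains
[M] already contains [K] or [L].  Every probability that competes in the infima
defining the depth of [M] therefore also competes in those defining the depth of
[K] or of [L], whence [D(M) >= min(D(K), D(L))] ([tukey_depth_between]).  When
[K] is deepest, this minimum is [D(L)].

The identities for the support function are obtained by exhibiting maximizers:
by compactness a convex body has a point of largest scalar product with [u], and
sums and nonnegative multiples of such points are again such points. *)

Section support_function.
Context {R : realType} {p : nat}.
Implicit Types (K L M : convex_body R p) (u x y : 'rV[R]_p).

Lemma dotrDl x y u : dotr (x + y) u = dotr x u + dotr y u.
Proof.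
by rewrite -big_split; apply: eq_bigr => i _; rewrite mxE mulrDl.
Qed.

Lemma dotrZl g x u : dotr (g *: x) u = g * dotr x u.
Proof. by rewrite mulr_sumr; apply: eq_bigr => i _; rewrite mxE mulrA. Qed.

Lemma dotr_continuous u : continuous (dotr (p := p) ^~ u).
Proof.
apply: continuous_big => [|i _]; first exact: add_continuous.
move=> x; apply: continuousM; last exact: cst_continuous.
exact: coord_continuous.
Qed.

Lemma support_functionE K u k : (K : set _) k ->
  (forall k', (K : set _) k' -> dotr k' u <= dotr k u) ->
  support_function K u = dotr k u.
Proof.
move=> Kk kmax.
have ubK : ubound [set dotr k' u | k' in (K : set _)] (dotr k u).
  by move=> _ [k' Kk' <-]; exact: kmax.
apply/eqP; rewrite eq_le; apply/andP; split.
  by apply: ge_sup => //; exists (dotr k u), k.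
by apply: ub_le_sup; [exists (dotr k u) | exists k].
Qed.

Lemma support_function_attained K u : exists k,
  [/\ (K : set _) k, support_function K u = dotr k u &
      forall k', (K : set _) k' -> dotr k' u <= dotr k u].
Proof.
have [k /set_mem Kk kmax] := EVT_max_rV (body_nonempty K)
  (@body_compact _ _ K) (continuous_subspaceT (dotr_continuous u)).
have {}kmax k' : (K : set _) k' -> dotr k' u <= dotr k u.
  by move=> Kk'; apply/kmax/mem_set.
by exists k; split=> //; exact: support_functionE.
Qed.

Lemma support_functionD K L u :
  support_function (minkowski_add K L) u =
  support_function K u + support_function L u.
Proof.
have [k [Kk -> kmax]] := support_function_attained K u.
have [l [Ll -> lmax]] := support_function_attained L u.
rewrite -dotrDl; apply: support_functionE; first by exists k => //; exists l.
move=> _ [k' Kk' [l' Ll' <-]].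
by rewrite !dotrDl lerD ?kmax ?lmax.
Qed.

Lemma support_functionZ g K u : 0 <= g ->
  support_function (minkowski_scale g K) u = g * support_function K u.
Proof.
move=> g0; have [k [Kk -> kmax]] := support_function_attained K u.
rewrite -dotrZl; apply: support_functionE; first by exists k.
by move=> _ [k' Kk' <-]; rewrite !dotrZl ler_wpM2l ?kmax.
Qed.

End support_function.

(** Quasi-concavity of the depth. The lower bound on [s_M] makes a halfspace
[s(u) <= t] containing [M] contain [K] or [L]; the upper bound does the same for
the halfspaces [s(u) >= t]. *)
Lemma tukey_depth_between (R : realType) (p : nat) (d : measure_display)
    (Omega : measurableType d) (P : probability Omega R)
    (Gamma : Omega -> convex_body R p) (K L M : convex_body R p) :
  (forall u, Num.min (support_function K u) (support_function L u)
     <= support_function M u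
     <= Num.max (support_function K u) (support_function L u)) ->
  (Order.min (tukey_depth P Gamma K) (tukey_depth P Gamma L)
   <= tukey_depth P Gamma M)%E.
Proof.
move=> KML; rewrite {3}/tukey_depth le_min.
apply/andP; split; apply/ereal_infP => _ [[u t] /= [u1 Mut] <-].
- have /andP[/le_trans/(_ Mut) + _] := KML u.
  rewrite ge_min => /orP[Kut|Lut]; rewrite !ge_min.
    by rewrite ereal_inf_lbound//; exists (u, t).
  by rewrite [X in _ || (X || _)]ereal_inf_lbound ?orbT//; exists (u, t).
- have /andP[_ /(le_trans Mut)] := KML u.
  rewrite le_max => /orP[Kut|Lut]; rewrite !ge_min.
    by rewrite [X in (_ || X) || _]ereal_inf_lbound ?orbT//; exists (u, t).
  by rewrite [X in _ || (_ || X)]ereal_inf_lbound ?orbT//; exists (u, t).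
Qed.

Theorem proposition4p5 (R : realType) (p : nat) (hp : (1 <= p)%N)
  (d : measure_display) (Omega : measurableType d) (P : probability Omega R)
  (Gamma : Omega -> convex_body R p)
  (hGamma : compact_convex_random_set Gamma)
  (K : convex_body R p)
  (hK : forall M : convex_body R p,
      (tukey_depth P Gamma M <= tukey_depth P Gamma K)%E)
  (lambda : R) (hlambda : 0 <= lambda <= 1) (L : convex_body R p) :
  (tukey_depth P Gamma L <=
   tukey_depth P Gamma
     (minkowski_add (minkowski_scale (1 - lambda) K)
                    (minkowski_scale lambda L)))%E.
Proof.
have /andP[l0 l1] := hlambda; have l1' : 0 <= 1 - lambda by rewrite subr_ge0.
rewrite -[leLHS](min_idPr (hK L)); apply: tukey_depth_between => u.
rewrite support_functionD !support_functionZ//.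
set a := support_function K u; set b := support_function L u.
(* The bounds on a combination of [a] and [b] are those of the same combination
   of two copies of their minimum, respectively their maximum. *)
have comb_id c : c = (1 - lambda) * c + lambda * c.
  by rewrite -mulrDl subrK mul1r.
rewrite {1}[Num.min a b]comb_id [Num.max a b]comb_id.
by rewrite !lerD ?ler_wpM2l ?ge_min ?le_max ?lexx ?orbT.
Qed.
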